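(* Let $d$ and $\Delta$ be integers with $1\le d\le\Delta$, and let $G$ be a finite simple $d$-degenerate graph with maximum degree $\Delta(G)\le\Delta$. Then $$q_B(G)\le \Delta+(d-1)\Delta_2(G)\le d\Delta.$$
   Context: A $B$-coloring of a graph $G$ is a proper edge-coloring (incident edges receive distinct colors) in which the edges of every $4$-cycle receive four distinct colors; $q_B(G)$ is the minimum number of colors in a $B$-coloring of $G$. The maximum codegree is $\Delta_2(G)=\max_{x\ne y}|N_G(x)\cap N_G(y)|$ over pairs of distinct vertices $x,y$ of $G$, with $\Delta_2(G)=0$ when $|V(G)|<2$; here $N_G(x)$ is the open neighborhood of $x$. A graph is $d$-degenerate if every nonempty subgraph has a vertex of degree at most $d$ (in that subgraph). $\Delta(G)$ denotes the maximum degree of $G$. *)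

(* Defs.v *)
From HB Require Import structures.
From mathcomp Require Import all_boot.

Set Implicit Arguments.
Unset Strict Implicit.
Unset Printing Implicit Defensive.

Record sgraph := SGraph {
  vertex :> finType;
  adj : rel vertex;
  adj_sym : symmetric adj;
  adj_irr : irreflexive adj
}.

Section Basics.
Variable G : sgraph.

Definition neighborhood (x : G) : {set G} := [set y | adj x y].

Definition max_degree : nat := \max_(x : G) #|neighborhood x|.

(* The maximum over an empty range is 0, so this is 0 when #|G| < 2. *)
Definition max_codegree : nat :=
  \max_(x : G) \max_(y : G | x != y) #|neighborhood x :&: neighborhood y|.

Definition edges : {set {set G}} :=
  [set f | [exists x : G, exists y : G, adj x y && (f == [set x; y])]].

Definition edge := {f : {set G} | f \in edges}.

(* Subgraphs need not be induced: S is the vertex set, F the edge set. *)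
Definition is_subgraph (S : {set G}) (F : {set {set G}}) : bool :=
  (F \subset edges) && [forall f in F, f \subset S].

Definition degree_in (F : {set {set G}}) (x : G) : nat :=
  #|[set f in F | x \in f]|.

Definition degenerate (d : nat) : Prop :=
  forall (S : {set G}) (F : {set {set G}}),
    is_subgraph S F -> S != set0 -> exists2 x, x \in S & degree_in F x <= d.

End Basics.

Section BColoring.
Variable G : sgraph.

Definition proper_edge_coloring (C : eqType) (c : edge G -> C) : bool :=
  [forall f : edge G, forall g : edge G,
     (f != g) && (val f :&: val g != set0) ==> (c f != c g)].

Definition C4_edges (x y z w : G) : {set {set G}} :=
  [set [set x; y]; [set y; z]; [set z; w]; [set w; x]].

Definition C4_rainbow (C : eqType) (c : edge G -> C) : bool :=
  [forall x : G, forall y : G, forall z : G, forall w : G,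
     ucycleb (@adj G) [:: x; y; z; w] ==>
     dinjectiveb c [pred f : edge G | val f \in C4_edges x y z w]].

Definition B_coloring (C : eqType) (c : edge G -> C) : bool :=
  proper_edge_coloring c && C4_rainbow c.

(* Only actual edges are colored, so an edgeless graph is 0-colorable. *)
Definition B_colorable (k : nat) : bool :=
  [exists c : {ffun edge G -> 'I_k}, B_coloring c].

Lemma B_colorable_ex : exists k, B_colorable k.
Proof.
exists #|{: edge G}|; apply/existsP; exists [ffun f => enum_rank f].
apply/andP; split.
  apply/forallP => f; apply/forallP => g; apply/implyP => /andP[fg _].
  by rewrite !ffunE (inj_eq enum_rank_inj).
apply/forallP => x; apply/forallP => y; apply/forallP => z; apply/forallP => w.
apply/implyP => _; apply/dinjectiveP => f g _ _.
by rewrite !ffunE => /enum_rank_inj.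
Qed.

Definition q_B : nat := ex_minn B_colorable_ex.

End BColoring.

(* Main.v *)
Require Import Defs.
From mathcomp Require Import all_boot.

(** Order the vertices so that each has at most [d] earlier neighbours, and
    color the edges greedily by increasing later endpoint.  When [vu] is colored,
    with [v] the later endpoint, every colored edge in conflict with it is either
    some [uw] with [w <> v] (at most [Delta - 1] edges), or some [u'w] with
    [u' <> u] an earlier neighbour of [v] and [w] a common neighbour of [u] and
    [u'] (at most [(d - 1) * max_codegree G] edges); the edges [vu'] at [v] are
    the case [w = v]. *)

(** * Greedy coloring of a finite graph *)

(** Once [S :\ e] is colored by induction, the fewer than [K] neighbours of [e] in [S] leave a color
    free for [e]. The order of coloring is thus produced by the recursion and never written down. *)
Lemma greedy_coloring (T : finType) (r : rel T) (K : nat) :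
    symmetric r -> irreflexive r ->
    (forall S : {set T}, S != set0 ->
       exists2 e, e \in S & #|[set f in S | r e f]| < K) ->
  exists c : {ffun T -> 'I_K}, forall e f, r e f -> c e != c f.
Proof.
move=> rsym rirr rK.
(* Colors are plain numbers, bounded by [K] only on [S]; this provides a default outside [S] without
   an inhabitant of ['I_K]. *)
have partial (S : {set T}) : exists2 c : T -> nat,
    {in S, forall e, c e < K} & {in S &, forall e f, r e f -> c e != c f}.
  have [n] := ubnP #|S|; elim: n S => // n IHn S; rewrite ltnS => Sn.
  have [->|/rK[e eS eK]] := eqVneq S set0.
    by exists (fun=> 0) => [e|e f]; rewrite inE.
  have [|c cK cr] := IHn (S :\ e).
    by rewrite (leq_trans _ Sn) // [leqRHS](cardsD1 e) eS.
  set N := [set f in S | r e f] in eK.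
  have NSe f : f \in N -> f \in S :\ e.
    rewrite !inE => /andP[-> ref]; rewrite andbT.
    by apply: contraTneq ref => ->; rewrite rirr.
  pose used := [set k : 'I_K | [exists f in N, c f == k]].
  have [k kN] : exists k : 'I_K, k \notin used.
    apply/existsP; rewrite -negb_forall; apply/negP => /forallP all_used.
    have: K <= size (undup [seq c f | f <- enum N]).
      rewrite -(size_iota 0 K); apply: uniq_leq_size (iota_uniq _ _) _ => k.
      rewrite mem_iota add0n => /= kK; rewrite mem_undup.
      have := all_used (Ordinal kK); rewrite inE => /exists_inP[f fN /eqP /= <-].
      by apply: map_f; rewrite mem_enum.
    rewrite leqNgt (leq_ltn_trans (size_undup _)) //.
    by rewrite size_map -cardE.
  have kc f : f \in S -> r e f -> c f != k.
    move=> fS ref; apply: contra kN => cf; rewrite inE; apply/exists_inP.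
    by exists f => //; rewrite inE fS.
  exists (fun f => if f == e then val k else c f) => [f fS|f g fS gS].
    by case: eqVneq => //= fe; apply: cK; rewrite !inE fe.
  case: (eqVneq f e) => [->|fe]; case: (eqVneq g e) => [->|ge].
  - by rewrite rirr.
  - by rewrite eq_sym; apply: kc.
  - by rewrite rsym; apply: kc.
  - by apply: cr; rewrite !inE ?fe ?ge.
have [c cK cr] := partial [set: T].
exists [ffun e => Ordinal (cK e (in_setT e))] => e f ref.
by rewrite !ffunE -val_eqE /= cr.
Qed.

Section Graph.
Variable G : sgraph.
Implicit Types (x y u v w : G) (e f : edge G).

(** * Edges as two-element sets, and vertex orderings *)

Lemma adj_neq x y : adj x y -> x != y.
Proof. by apply: contraTneq => ->; rewrite adj_irr. Qed.

Lemma edge_ends e x : x \in val e ->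
  exists2 y, adj x y & val e = [set x; y].
Proof.
case: e => e /=; rewrite inE => /existsP[a /existsP[b /andP[ab /eqP->]]].
rewrite !inE => /orP[]/eqP->; first by exists b.
by exists a; rewrite ?(adj_sym b) // setUC.
Qed.

Lemma edge_neq0 e : exists x, x \in val e.
Proof.
have := valP e; rewrite inE => /existsP[a /existsP[b /andP[_ /eqP->]]].
by exists a; rewrite !inE eqxx.
Qed.

Lemma set2_inj x : injective (fun y => [set x; y]).
Proof.
move=> y z eq2; have := set22 x y; have := set22 x z.
rewrite -{1}eq2 {2}eq2 !inE.
by case/orP=> /eqP-> // /orP[]/eqP->.
Qed.

(** Some vertex of [A] has at most [d] neighbours in [A]; it is ranked last, and the rest of [A] is
    ordered by induction. *)
Lemma degenerate_order (d : nat) : degenerate G d ->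
  exists2 r : G -> nat, injective r &
    forall v, #|[set u | adj v u && (r u < r v)]| <= d.
Proof.
move=> degG.
have partial (A : {set G}) : exists2 r : G -> nat, {in A &, injective r} &
    {in A, forall v, #|[set u in A | adj v u && (r u < r v)]| <= d}.
  have [n] := ubnP #|A|; elim: n A => // n IHn A; rewrite ltnS => An.
  have [->|A0] := eqVneq A set0.
    by exists (fun=> 0) => [u v|v]; rewrite inE.
  (* Degeneracy is applied to the induced subgraph on [A], where the degree counts all neighbours in
     [A]. *)
  pose F := [set f in edges G | f \subset A].
  have [|v vA vd] := degG A F _ A0.
    apply/andP; split; first by apply/subsetP => f; rewrite inE => /andP[].
    by apply/forall_inP => f; rewrite inE => /andP[].
  have {}vd : #|[set u in A | adj v u]| <= d.
    apply: leq_trans vd; rewrite -(card_imset _ (set2_inj v)).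
    apply/subset_leq_card/subsetP => _ /imsetP[u + ->]; rewrite inE => /andP[uA vu].
    rewrite !inE eqxx andbT; apply/andP; split.
      by apply/existsP; exists v; apply/existsP; exists u; rewrite vu /=.
    by apply/subsetP => x; rewrite !inE => /orP[]/eqP->.
  have [|r rinj rd] := IHn (A :\ v).
    by rewrite (leq_trans _ An) // [leqRHS](cardsD1 v) vA.
  (* [M] exceeds every value of [r], so [v] comes last and never becomes an earlier neighbour of
     another vertex. *)
  pose M := (\max_x r x).+1.
  have rM x : r x < M by rewrite ltnS leq_bigmax.
  exists (fun x => if x == v then M else r x) => [x y xA yA|x xA].
    have [->|xv] := eqVneq x v; have [->|yv] := eqVneq y v => //.
    - by move=> eqM; have := rM y; rewrite -eqM ltnn.
    - by move=> eqM; have := rM x; rewrite eqM ltnn.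
    - by apply: rinj; rewrite !inE ?xv ?yv.
  have [->|xv] := eqVneq x v.
    apply: leq_trans vd; apply/subset_leq_card/subsetP => u.
    by rewrite !inE => /and3P[-> ->].
  have xAv : x \in A :\ v by rewrite !inE xv.
  apply: leq_trans (rd x xAv); apply/subset_leq_card/subsetP => u.
  rewrite !inE; case: (eqVneq u v) => [->|uv] /=.
    by rewrite ltnNge (ltnW (rM x)) !andbF.
  by [].
have [r rinj rd] := partial [set: G].
exists r => [u v|v]; first by apply: rinj; rewrite inE.
apply: leq_trans (rd v (in_setT v)); apply/subset_leq_card/subsetP => u.
by rewrite !inE.
Qed.

(** * Conflicting edges and B-colorings *)

(* Coincidences among [x, y, z, w] are harmless: they force [e] and [f] to be
   equal or incident. *)
Definition conflict : rel (edge G) := fun e f => (e != f) &&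
  ((val e :&: val f != set0) ||
   [exists x, exists y, exists z, exists w,
     [&& val e == [set x; y], val f == [set z; w], adj y z & adj w x]]).

Lemma opposite_conflict e f x y z w : e != f ->
    val e = [set x; y] -> val f = [set z; w] -> adj y z -> adj w x ->
  conflict e f.
Proof.
move=> ef eE fE yz wx; rewrite /conflict ef /=; apply/orP; right.
apply/existsP; exists x; apply/existsP; exists y; apply/existsP; exists z.
by apply/existsP; exists w; rewrite eE fE !eqxx yz.
Qed.

Lemma incident_conflict e f x : e != f -> x \in val e -> x \in val f ->
  conflict e f.
Proof.
move=> ef xe xf; rewrite /conflict ef /=; apply/orP; left.
by apply/set0Pn; exists x; rewrite inE xe.
Qed.

Lemma conflictP e f : conflict e f -> e != f /\
  ((exists x, (x \in val e) && (x \in val f)) \/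
   exists x y z w, [/\ val e = [set x; y], val f = [set z; w],
     adj y z & adj w x]).
Proof.
case/andP=> ef conf; split=> //.
case/orP: conf => [/set0Pn[x xef]|/existsP[x /existsP[y]]].
  by left; exists x; rewrite -in_setI.
case/existsP=> z /existsP[w].
by case/and4P=> /eqP? /eqP? ? ?; right; exists x, y, z, w.
Qed.

Lemma conflict_sym : symmetric conflict.
Proof.
suff sub e f : conflict e f -> conflict f e.
  by move=> e f; apply/idP/idP; apply: sub.
case/conflictP=> ef; rewrite eq_sym in ef.
case=> [[x /andP[xe xf]]|[x [y [z [w [eE fE yz wx]]]]]].
  exact: incident_conflict xf xe.
exact: opposite_conflict fE eE wx yz.
Qed.

Lemma conflict_irr : irreflexive conflict.
Proof. by move=> e; rewrite /conflict eqxx. Qed.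

(** Two distinct edges of a 4-cycle are either incident or opposite, and [conflict] covers both
    situations. *)
Lemma conflict_B_coloring (C : eqType) (c : edge G -> C) :
  (forall e f, conflict e f -> c e != c f) -> B_coloring c.
Proof.
move=> cP; apply/andP; split.
  apply/forallP => e; apply/forallP => f; apply/implyP => /andP[ef /set0Pn[x]].
  by rewrite inE => /andP[xe xf]; apply: cP; apply: incident_conflict xe xf.
apply/forallP => x; apply/forallP => y; apply/forallP => z; apply/forallP => w.
apply/implyP => /andP[/= /and5P[xy yz zw wx _] _].
have C4P (g : edge G) : val g \in C4_edges x y z w ->
    [\/ val g = [set x; y], val g = [set y; z], val g = [set z; w]
      | val g = [set w; x]].
  rewrite !inE -!orbA => /or4P[]/eqP gE.
  - by constructor 1.
  - by constructor 2.
  - by constructor 3.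
  - by constructor 4.
apply/dinjectiveP => e f /C4P eC /C4P fC; apply: contra_eq => ef; apply: cP.
have inc t := incident_conflict e f t ef.
(* Of the sixteen ordered pairs of sides, four coincide, eight share a vertex and four are
   opposite. *)
case: eC => eE; case: fC => fE;
  first [ by case/eqP: ef; apply: val_inj; rewrite eE fE
        | by apply: (inc x); rewrite ?eE ?fE !inE eqxx ?orbT
        | by apply: (inc y); rewrite ?eE ?fE !inE eqxx ?orbT
        | by apply: (inc z); rewrite ?eE ?fE !inE eqxx ?orbT
        | by apply: (inc w); rewrite ?eE ?fE !inE eqxx ?orbT
        | exact: (opposite_conflict e f _ _ _ _ ef eE fE) ].
Qed.

(** * Counting conflicts *)

Lemma degree_le x : #|neighborhood x| <= max_degree G.
Proof. exact: (leq_bigmax_cond (F := fun x => #|neighborhood x|)). Qed.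

Lemma codegree_le x y : x != y ->
  #|neighborhood x :&: neighborhood y| <= max_codegree G.
Proof.
move=> xy; apply: leq_trans (leq_bigmax_cond _ (isT : xpredT x)).
exact: (leq_bigmax_cond (F := fun y => #|neighborhood x :&: neighborhood y|)).
Qed.

Lemma max_codegree_le : max_codegree G <= max_degree G.
Proof.
apply/bigmax_leqP => x _; apply/bigmax_leqP => y _.
exact: leq_trans (subset_leq_card (subsetIl _ _)) (degree_le x).
Qed.

Section Order.
Variables (r : G -> nat) (d : nat).
Hypothesis r_inj : injective r.
Hypothesis back_le : forall v, #|[set u | adj v u && (r u < r v)]| <= d.

(** Among the endpoints of edges in [S], take the vertex [v] of largest rank, and let [e] be any
    edge of [S] at [v]. This [e] plays the part of the edge colored last, so the edges of [S]
    contain only [v] and earlier vertices. *)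
Lemma few_conflicts (S : {set edge G}) : S != set0 ->
  exists2 e, e \in S &
    #|[set f in S | conflict e f]| < max_degree G + (d - 1) * max_codegree G.
Proof.
case/set0Pn=> e0 e0S; have [v0 v0e] := edge_neq0 e0.
pose P v := [exists f in S, v \in val f].
have P0 : P v0 by apply/exists_inP; exists e0.
case: (arg_maxnP r P0) => v /exists_inP[e eS ve] v_max.
have [u vu eE] := edge_ends _ _ ve.
have last f x : f \in S -> x \in val f -> x != v -> r x < r v.
  move=> fS xf xv; rewrite ltn_neqAle (inj_eq r_inj) xv.
  by apply: v_max; apply/exists_inP; exists f.
have uv : u != v by rewrite eq_sym adj_neq.
pose B := [set u' | adj v u' && (r u' < r v)].
have uB : u \in B by rewrite inE vu (last e) // eE !inE eqxx orbT.
pose F1 := [set [set u; w] | w in neighborhood u :\ v].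
pose F2 u' := [set [set u'; w] | w in neighborhood u :&: neighborhood u'].
(* [F1] holds the edges at [u] other than [e]; [F2 u'] joins [u'] to its common neighbours with [u].
   These sets may contain edges outside [S], which is harmless for an upper bound. *)
have sub : val @: [set f in S | conflict e f]
    \subset F1 :|: \bigcup_(u' in B :\ u) F2 u'.
  have inF2 f u' w : f \in S -> u' \in val f -> u' != v -> u' != u ->
      adj v u' -> adj u w -> val f = [set u'; w] ->
    val f \in F1 :|: \bigcup_(u' in B :\ u) F2 u'.
    move=> fS u'f u'v u'u vu' uw fE; rewrite inE; apply/orP; right.
    apply/bigcupP; exists u'; first by rewrite !inE u'u vu' (last f).
    (* Since [f] is an edge, [w] is adjacent to [u'] as well as to [u]. *)
    have [w' u'w' fE'] := edge_ends _ _ u'f.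
    rewrite fE (imset_f (fun w => [set u'; w])) // !inE uw.
    by move: fE'; rewrite fE => /set2_inj->.
  apply/subsetP => _ /imsetP[f + ->]; rewrite inE => /andP[fS ef].
  case/conflictP: (ef) => enf.
  have [uf _|uNf] := boolP (u \in val f).
    have [w uw fE] := edge_ends _ _ uf; rewrite inE; apply/orP; left.
    rewrite fE (imset_f (fun w => [set u; w])) // !inE uw andbT.
    by apply: contraNneq enf => wv; rewrite -val_eqE /= eE fE wv setUC.
  have [vf _|vNf] := boolP (v \in val f).
    have [w vw fE] := edge_ends _ _ vf.
    (* Here [w] is the earlier neighbour of [v], and [v] itself is the common neighbour of [u] and
       [w]. *)
    apply: (inF2 f w v) => //; rewrite 1?fE ?inE ?eqxx ?orbT //.
    - by rewrite eq_sym adj_neq.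
    - by apply: contraNneq uNf => <-; rewrite fE !inE eqxx orbT.
    - by rewrite adj_sym.
    - by rewrite setUC.
  case=> [[x]|[x [y [z [w [eE' fE yz wx]]]]]].
    by rewrite eE => /andP[/set2P[]->]; [rewrite (negPf vNf)|rewrite (negPf uNf)].
  have zf : z \in val f by rewrite fE !inE eqxx.
  have wf : w \in val f by rewrite fE !inE eqxx orbT.
  have neqs t : t \in val f -> t != v /\ t != u.
    move=> tf; split; first by apply: contraNneq vNf => <-.
    by apply: contraNneq uNf => <-.
  have [zv zu] := neqs z zf; have [wv wu] := neqs w wf.
  (* Whichever of [x], [y] is [v], the end of [f] adjacent to [v] serves as [u'], and the other end
     is adjacent to [u]. *)
  have /set2P[vE|vE] : v \in [set x; y] by rewrite -eE'.
    rewrite -vE in eE' yz wx.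
    have uy : u = y by apply: (set2_inj v); rewrite -eE.
    rewrite -uy in yz; rewrite setUC in fE; rewrite adj_sym in wx.
    exact: (inF2 f w z).
  rewrite -vE in eE' yz wx.
  have ux : u = x by apply: (set2_inj v); rewrite -eE eE' setUC.
  rewrite -ux adj_sym in wx.
  exact: (inF2 f z w).
exists e => //; rewrite -(card_imset _ val_inj).
apply: leq_ltn_trans (subset_leq_card sub) _.
(* The strict inequality comes from [F1], where [v] is removed from the neighbours of [u]. *)
apply: leq_ltn_trans (leq_card_setU _ _) _; rewrite -addSn leq_add //.
  apply: leq_ltn_trans (leq_imset_card _ _) _.
  apply: leq_trans (degree_le u).
  by rewrite [ltnRHS](cardsD1 v) inE adj_sym vu.
have union_le (A : {set G}) : #|\bigcup_(u' in A) F2 u'| <= \sum_(u' in A) #|F2 u'|.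
  elim/big_rec2: _ => [|i m U _ IH]; first by rewrite cards0.
  by apply: leq_trans (leq_card_setU _ _) _; rewrite leq_add2l.
apply: leq_trans (union_le _) _.
apply: (@leq_trans (\sum_(u' in B :\ u) max_codegree G)).
  apply: leq_sum => u'; rewrite !inE => /andP[u'u _].
  apply: leq_trans (leq_imset_card _ _) _.
  by apply: codegree_le; rewrite eq_sym.
rewrite sum_nat_const leq_mul2r; apply/orP; right.
(* As [u] lies in [B], at most [d - 1] earlier neighbours of [v] remain. *)
have := back_le v; rewrite -/B (cardsD1 u) uB add1n => Bd.
by rewrite subn1 -ltnS (leq_trans Bd) // leqSpred.
Qed.

End Order.

Lemma q_B_le (d : nat) : degenerate G d ->
  q_B G <= max_degree G + (d - 1) * max_codegree G.
Proof.
move=> /degenerate_order[r r_inj back_le].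
have [c cP] := greedy_coloring _ _ _ conflict_sym conflict_irr
  (few_conflicts r d r_inj back_le).
rewrite /q_B; case: ex_minnP => q _; apply.
by apply/existsP; exists c; apply: conflict_B_coloring.
Qed.

End Graph.

Theorem theorem1p1 (d Delta : nat) (G : sgraph) (hd : 1 <= d)
    (hdDelta : d <= Delta) (hG : degenerate G d)
    (hDelta : max_degree G <= Delta) :
  q_B G <= Delta + (d - 1) * max_codegree G /\
  Delta + (d - 1) * max_codegree G <= d * Delta.
Proof.
split; first by apply: leq_trans (q_B_le G d hG) _; rewrite leq_add2r.
(* By [hd], [d * Delta] splits as [Delta + (d - 1) * Delta], leaving the codegree to be compared
   with [Delta]. *)
rewrite -{2}(subnK hd) addn1 mulSn leq_add2l leq_mul2l.
by rewrite (leq_trans (max_codegree_le G) hDelta) orbT.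
Qed.
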